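(* Let $m\in\mathbb{N}$ and $k\in\mathbb{Z}$. The sequence $$a(n,2m+1,k)=\sum_{j\in\mathbb{Z}}(-1)^j\binom{n}{\left\lfloor\frac{n-(2m+1)j+k}{2}\right\rfloor},\qquad n\in\mathbb{N},$$ satisfies the recurrence relation $$\bigl(F_{m+1}(E,-1)-F_m(E,-1)\bigr)\,a(n,2m+1,k)=0\quad\text{for all } n\in\mathbb{N}.$$
   Context: $\mathbb{N}=\{0,1,2,\dots\}$. For $n\in\mathbb{N}$ and $i\in\mathbb{Z}$, $\binom{n}{i}$ is the usual binomial coefficient, equal to $0$ if $i<0$ or $i>n$; hence the sum over $j$ has only finitely many nonzero terms. $\lfloor\cdot\rfloor$ is the floor function. The Fibonacci polynomials $F_n(x,s)$ are defined by $F_0(x,s)=0$, $F_1(x,s)=1$ and $F_n(x,s)=xF_{n-1}(x,s)+sF_{n-2}(x,s)$ for $n\ge 2$; for $n\ge1$, $F_n(x,s)=\sum_{k=0}^{n-1}\binom{n-1-k}{k}s^kx^{n-2k-1}$ (terms with zero binomial coefficient being omitted). $E$ is the shift operator in the variable $n$: for a polynomial $p(x)=\sum_{i=0}^{d}a_ix^i$ and a function $f$ of $n\in\mathbb{N}$ (possibly depending on further parameters, which are kept fixed), $p(E)f(n)=\sum_{i=0}^{d}a_if(n+i)$. Here $F_m(E,-1)$ denotes $p(E)$ for $p(x)=F_m(x,-1)$. *)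

(* Defs.v *)
From mathcomp Require Import all_boot all_order all_algebra.
From mathcomp Require Import boolp classical_sets functions cardinality fsbigop.
From mathcomp Require Import zify.

Set Implicit Arguments.
Unset Strict Implicit.
Unset Printing Implicit Defensive.

Import Order.TTheory GRing.Theory Num.Theory.

Local Open Scope ring_scope.

Definition binz (n : nat) (i : int) : int :=
  if i is Posz j then 'C(n, j)%:Z else 0.

(* F_n(x, s), as a polynomial in x with s a fixed element of the coefficient
   ring. *)
Fixpoint fib_poly (R : comNzRingType) (s : R) (n : nat) : {poly R} :=
  match n with
  | 0 => 0
  | n1.+1 =>
    match n1 with
    | 0 => 1
    | n2.+1 => 'X * fib_poly s n1 + s *: fib_poly s n2
    end
  end.

(* p(E) f, with E the shift operator (E f) n = f (n + 1). *)
Definition poly_shift (R : comNzRingType) (p : {poly R}) (f : nat -> R) :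
    nat -> R :=
  fun n => \sum_(i < size p) p`_i * f (n + i)%N.

(* Here %/ is integer division: since the divisor is positive, (z %/ 2)%Z is
   the floor of z / 2, also for z < 0.  The sum over [set: int] adds the
   nonzero terms; these are finitely many when l > 0 (aseq_summand_finite),
   whereas by the library's convention the sum is 0 if the support is
   infinite. *)
Definition aseq_summand (n l : nat) (k j : int) : int :=
  (-1) ^ j * binz n ((n%:Z - l%:Z * j + k) %/ 2)%Z.

Definition aseq (n l : nat) (k : int) : int :=
  \sum_(j \in [set: int]%classic) aseq_summand n l k j.

Lemma aseq_summand_finite (n l : nat) (k : int) : (0 < l)%N ->
  finite_set [set j : int | aseq_summand n l k j != 0]%classic.
Proof.
move=> l0; pose B := (n + `|k| + 2)%N.
apply: (@sub_finite_set _ _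
  ((fun i : nat => i%:Z - B%:Z) @` `I_(B + B).+1)%classic); last first.
  exact/finite_image/finite_II.
move=> j /=; rewrite /aseq_summand mulf_eq0 negb_or => /andP[_].
have := divz_eq (n%:Z - l%:Z * j + k) 2.
have := modz_ge0 (n%:Z - l%:Z * j + k) (isT : 2 != 0 :> int).
have := ltz_pmod (n%:Z - l%:Z * j + k) (isT : 0 < 2 :> int).
set q := (_ %/ _)%Z; set r := (_ %% _)%Z => r2 r0 E.
case: q E => // q E; rewrite /binz -lt0n bin_gt0 => qn.
have jB : - B%:Z <= j <= B%:Z.
  have lj : - B%:Z <= l%:Z * j <= B%:Z by rewrite /B; lia.
  by case/andP: lj => lj1 lj2; apply/andP; split; nia.
by exists (absz (j + B%:Z)); lia.
Qed.

(* Main.v *)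
(* Write l = 2m+1.  Pascal's rule gives a(n+1,k) = a(n,k+1) + a(n,k-1), so E
   acts as T + T^-1 with T the shift in k.  Since
   F_(m+1)(T + T^-1, -1) - F_m(T + T^-1, -1) = sum_(0 <= i <= 2m) (-1)^i T^(m-i),
   one has to show that the l consecutive values a(n,k+m), ..., a(n,k-m) have
   alternating sum 0.  The half-index binomial C(n, floor(y/2)) has the form
   h(y) + h(y+1), with h supported on the odd integers; hence the alternating
   sum over i telescopes, and as l is odd the j-th term of what remains is
   (-1)^j (h(z - l j) + h(z - l (j+1))), which telescopes over j. *)
Require Import Defs.
From mathcomp Require Import all_boot all_order all_algebra.
From mathcomp Require Import boolp classical_sets functions cardinality fsbigop.
From mathcomp Require Import zify ring.

Import GRing.Theory.

Local Open Scope ring_scope.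

(** Padding with zero coefficients puts polynomials of different sizes over one index range; sizes
    may drop under addition or scaling. *)
Lemma poly_shift_widen (R : comNzRingType) (p : {poly R}) f n N :
  (size p <= N)%N -> poly_shift p f n = \sum_(i < N) p`_i * f (n + i)%N.
Proof.
move=> pN; rewrite /poly_shift.
rewrite (big_ord_widen _ (fun i => p`_i * f (n + i)%N) pN).
rewrite big_mkcond; apply: eq_bigr => i _; case: ltnP => // /leq_sizeP-> //.
by rewrite mul0r.
Qed.

Lemma poly_shiftD (R : comNzRingType) (p q : {poly R}) f n :
  poly_shift (p + q) f n = poly_shift p f n + poly_shift q f n.
Proof.
rewrite !(@poly_shift_widen _ _ _ _ (maxn (size p) (size q))) ?size_polyD //;
  rewrite ?leq_maxl ?leq_maxr //.
by rewrite -big_split; apply: eq_bigr => i _; rewrite coefD mulrDl.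
Qed.

Lemma poly_shiftZ (R : comNzRingType) c (p : {poly R}) f n :
  poly_shift (c *: p) f n = c * poly_shift p f n.
Proof.
rewrite (poly_shift_widen _ _ _ _ _ (size_scale_leq c p)) /poly_shift mulr_sumr.
by apply: eq_bigr => i _; rewrite coefZ mulrA.
Qed.

Lemma poly_shiftX (R : comNzRingType) (p : {poly R}) f n :
  poly_shift ('X * p) f n = poly_shift p f n.+1.
Proof.
rewrite mulrC (@poly_shift_widen _ _ _ _ (size p).+1); last first.
  by apply: leq_trans (size_polyMleq _ _) _; rewrite size_polyX addn2.
rewrite big_ord_recl coefMX mul0r add0r; apply: eq_bigr => i _.
by rewrite coefMX /= addnS addSn.
Qed.

(** Both sides satisfy [D (m+2) = E D (m+1) - D m]: on the left by the Fibonacci recurrence, on the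
    right because [E] acts as a shift of [k] by 1 plus a shift by -1. *)
Lemma poly_shift_fib (R : comNzRingType) (A : nat -> int -> R) m k n :
  (forall n k, A n.+1 k = A n (k + 1) + A n (k - 1)) ->
  poly_shift (fib_poly (-1) m.+1) (A ^~ k) n -
    poly_shift (fib_poly (-1) m) (A ^~ k) n =
  \sum_(i < (2 * m).+1) (-1) ^+ i * A n (k + m%:Z - i%:Z).
Proof.
move=> AS; have shift0 f p : poly_shift (0 : {poly R}) f p = 0.
  by rewrite /poly_shift size_poly0 big_ord0.
have shift1 f p : poly_shift (1 : {poly R}) f p = f p.
  by rewrite /poly_shift size_poly1 big_ord1 coef1 mul1r addn0.
have shiftSS f p q : poly_shift (fib_poly (-1 : R) p.+2) f q =
    poly_shift (fib_poly (-1) p.+1) f q.+1 - poly_shift (fib_poly (-1) p) f q.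
  by rewrite [fib_poly _ p.+2]/= poly_shiftD poly_shiftX poly_shiftZ mulN1r.
elim/ltn_ind: m k n => -[|[|m]] IHm k n.
- by rewrite shift0 shift1 big_ord1 subr0 mul1r addr0 subr0.
- rewrite shiftSS shift0 !shift1 AS muln1 !big_ord_recr big_ord0 /= !subr0 addrK.
  rewrite (_ : k + 1 - 2%:Z = k - 1); last by lia.
  ring.
rewrite (shiftSS _ m.+1) [X in _ - X]shiftSS.
transitivity
  (\sum_(i < (2 * m.+1).+1) (-1) ^+ i * A n.+1 (k + m.+1%:Z - i%:Z) -
   \sum_(i < (2 * m).+1) (-1) ^+ i * A n (k + m%:Z - i%:Z)).
  by rewrite -IHm // -IHm //; ring.
rewrite (eq_bigr (fun i : 'I_(2 * m.+1).+1 =>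
    (-1) ^+ i * A n (k + m.+2%:Z - i%:Z) +
    (-1) ^+ i * A n (k + m%:Z - i%:Z))); last first.
  by move=> i _; rewrite AS mulrDr; congr (_ * A _ _ + _ * A _ _); lia.
have odd2 p : (2 * p.+1 = (2 * p).+2)%N by lia.
pose S L z := \sum_(i < L) (-1) ^+ i * A n (z - i%:Z).
have SS L z : S L.+1 z = S L z + (-1) ^+ L * A n (z - L%:Z).
  exact: big_ord_recr.
rewrite big_split /= !odd2 -!/(S _ _) !SS.
(* The first [2m+1] terms centred at [k + m] cancel; the two left over are the last two terms of the
   longer sum centred at [k + m + 2]. *)
rewrite (_ : k + m.+2%:Z - (2 * m).+3%:Z = k + m%:Z - (2 * m).+1%:Z);
  last by lia.
rewrite (_ : k + m.+2%:Z - (2 * m).+4%:Z = k + m%:Z - (2 * m).+2%:Z);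
  last by lia.
by rewrite !exprS; ring.
Qed.

Lemma binzS n i : binz n.+1 i = binz n i + binz n (i - 1).
Proof.
case: i => [[|i]|i] //; first by rewrite /= !bin0.
by rewrite (_ : i.+1%:Z - 1 = i%:Z) /= ?binS ?PoszD //; lia.
Qed.

Lemma aseq_summandS n l k j :
  aseq_summand n.+1 l k j =
  aseq_summand n l (k + 1) j + aseq_summand n l (k - 1) j.
Proof.
rewrite /aseq_summand binzS mulrDr; congr (_ * binz _ _ + _ * binz _ _); lia.
Qed.

Lemma aseq_summand_eq0 n l k j : (0 < l)%N -> (n + `|k| + 2 < `|j|)%N ->
  aseq_summand n l k j = 0.
Proof.
move=> l0 jB; rewrite /aseq_summand.
case E: (_ %/ 2)%Z => [q|q]; last by rewrite mulr0.
rewrite /binz bin_small ?mulr0 //.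
have lj : (`|j| <= `|(l%:Z * j)%R|)%N by rewrite abszM leq_pmull.
lia.
Qed.

(** The bound [B] is left free so that sums with different [n] and [k] can share one finite
    window. *)
Lemma aseq_window n l k B : (0 < l)%N -> (n + `|k| + 2 <= B)%N ->
  aseq n l k = \sum_(i < B.*2.+1) aseq_summand n l k (i%:Z - B%:Z).
Proof.
move=> l0 nB; pose r := [seq i%:Z - B%:Z | i <- iota 0 B.*2.+1].
rewrite /aseq (@fsbigE _ _ _ _ _ r) //.
- rewrite big_map (eq_bigl xpredT) => [|i]; last by rewrite in_setT.
  rewrite -[RHS](big_mkord xpredT (fun i => aseq_summand n l k (i%:Z - B%:Z))).
  by rewrite /index_iota subn0.
- by rewrite map_inj_uniq ?iota_uniq // => i j /addIr[].
move=> j _ jB; apply: aseq_summand_eq0 => //.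
rewrite ltnNge; apply: contra jB => jB.
by apply/mapP; exists `|(j + B%:Z)%R|%N; rewrite ?mem_iota; lia.
Qed.

Lemma aseqS n l k : (0 < l)%N ->
  aseq n.+1 l k = aseq n l (k + 1) + aseq n l (k - 1).
Proof.
(* Large enough for [n.+1] with [k] and for [n] with [k + 1] and [k - 1]. *)
move=> l0; pose B := (n + `|k| + 4)%N.
rewrite !(@aseq_window _ _ _ B) //; try lia.
by rewrite -big_split; apply: eq_bigr => i _; exact: aseq_summandS.
Qed.

(** This is the function h of the outline: the coefficient of x^y in x (1 + x^2)^n. *)
Definition binz_odd n (y : int) :=
  if (y %% 2)%Z == 1 then binz n (y %/ 2)%Z else 0.

(** Exactly one of [y] and [y + 1] is odd, and its half has the same floor as that of [y]. *)
Lemma binz_half n y : binz n (y %/ 2)%Z = binz_odd n y + binz_odd n (y + 1).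
Proof.
rewrite /binz_odd; case: eqP => y2; case: eqP => y3; try lia;
  rewrite ?addr0 ?add0r //.
by congr binz; lia.
Qed.

Lemma alternating_binz_half n L y :
  \sum_(i < L) (-1) ^+ i * binz n ((y - i%:Z) %/ 2)%Z =
  binz_odd n (y + 1) - (-1) ^+ L * binz_odd n (y + 1 - L%:Z).
Proof.
elim: L => [|L IHL]; first by rewrite big_ord0 subr0 expr0 mul1r subrr.
rewrite big_ord_recr /= IHL binz_half exprS.
rewrite (_ : y - L%:Z + 1 = y + 1 - L%:Z); last by lia.
rewrite (_ : y + 1 - L.+1%:Z = y - L%:Z); last by lia.
ring.
Qed.

Lemma alternating_aseq n m k :
  \sum_(i < (2 * m).+1) (-1) ^+ i * aseq n (2 * m).+1 (k - i%:Z) = 0.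
Proof.
(* The summand [l] in [B] absorbs the shifts [k - i] with [i < l]. *)
set l := (2 * m).+1; pose B := (n + `|k| + l + 3)%N.
pose G (j : nat) : int :=
  (-1) ^ (j%:Z - B%:Z) * binz_odd n (n%:Z - l%:Z * (j%:Z - B%:Z) + k + 1).
transitivity (\sum_(0 <= j < B.*2.+1) - (G j.+1 - G j)).
  rewrite (eq_bigr (fun i : 'I_l => \sum_(j < B.*2.+1)
      (-1) ^+ i * aseq_summand n l (k - i%:Z) (j%:Z - B%:Z))).
    rewrite exchange_big big_mkord; apply: eq_bigr => j _ /=.
    set x := j%:Z - B%:Z; set y := n%:Z - l%:Z * x + k.
    transitivity
      ((-1) ^ x * \sum_(i < l) (-1) ^+ i * binz n ((y - i%:Z) %/ 2)%Z).
      rewrite mulr_sumr; apply: eq_bigr => i _.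
      by rewrite mulrCA /aseq_summand /y addrA.
    rewrite alternating_binz_half /G -/x.
    rewrite (_ : j.+1%:Z - B%:Z = x + 1); last by lia.
    rewrite (_ : n%:Z - l%:Z * (x + 1) + k + 1 = y + 1 - l%:Z);
      last by rewrite /y; ring.
    (* Oddness of [l] gives both h-terms the same sign, matching the sign change from [G j] to
       [G j.+1]. *)
    rewrite -signr_odd (_ : odd l = true); last by rewrite /l; lia.
    rewrite (exprzDr (unitrN1 _)).
    ring.
  move=> i _; rewrite (@aseq_window _ _ _ B) ?mulr_sumr //.
  by have := ltn_ord i; lia.
rewrite sumrN telescope_sumr // /G.
(* Only the two end values of [G] remain: at [j = 0] the argument of h exceeds [2n+1], and at
   [j = 2B+1] it is negative. *)
have binz_odd_eq0 y : (y < 0) || (2 * n%:Z + 1 < y) -> binz_odd n y = 0.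
  move=> yn; rewrite /binz_odd; case: ifP => // _.
  case E: (y %/ 2)%Z => [q|//]; rewrite /= bin_small //; lia.
rewrite !binz_odd_eq0 ?mulr0 ?subrr ?oppr0 //; nia.
Qed.

Theorem theorem1 (m : nat) (k : int) (n : nat) :
  let a := fun n' : nat => aseq n' (2 * m + 1)%N k in
  poly_shift (fib_poly (-1) m.+1) a n - poly_shift (fib_poly (-1) m) a n = 0.
Proof.
move=> a; rewrite /a addn1.
rewrite (@poly_shift_fib _ (fun n' k' => aseq n' (2 * m).+1 k')).
  exact: alternating_aseq.
by move=> p q; exact: aseqS.
Qed.
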